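(* Let $\Gamma$ be a finite simplicial graph with vertex set $V$ and let $G_\Gamma$ be the associated right-angled Artin group. Fix $n\ge1$, and suppose that it is not the case that $\Gamma$ is a complete graph with fewer than $n$ vertices. For each $L$, let $w_1,\dots,w_n$ be words on $V^{\pm}$ chosen uniformly at random from among all freely reduced words of length at most $L$, and let $g_1,\dots,g_n\in G_\Gamma$ be the elements they represent. Then the probability that $G_\Gamma$ commands $\{g_1,\dots,g_n\}$ converges to $1$ as $L\to\infty$.
   Context: The right-angled Artin group $G_\Gamma$ has generating set $V$ and relations $[v_1,v_2]=1$ whenever $v_1,v_2\in V$ are adjacent in $\Gamma$. $V^{\pm}$ denotes the set of generators and their inverses. A group $G$ commands $\{g_1,\dots,g_n\}\subset G$ if there is an integer $N>0$ such that for any integers $r_1,\dots,r_n>0$ there is a homomorphism to a finite group $G\to\bar G$, $g\mapsto\bar g$, such that $\bar g_i$ has order $Nr_i$ for each $i$. *)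

(* Defs.v *)
From HB Require Import structures.
From mathcomp Require Import all_boot all_order all_algebra all_fingroup.
From mathcomp Require Import all_classical all_reals all_analysis.

Set Implicit Arguments.
Unset Strict Implicit.
Unset Printing Implicit Defensive.

(* A finite simplicial graph is a symmetric irreflexive relation e on a finType
   V; the vertices x and y are adjacent when e x y. *)
Definition complete_graph (V : finType) (e : rel V) : Prop :=
  forall x y : V, x != y -> e x y.

(* The letter (v, false) is the generator v, and (v, true) is v^-1. *)
Definition letter (V : finType) : finType := (V * bool)%type.

Definition inv_letter (V : finType) (a : letter V) : letter V := (a.1, ~~ a.2).

Definition freely_reduced (V : finType) (w : seq (letter V)) : bool :=
  sorted (fun a b => b != inv_letter a) w.

(* The congruence on words over V^{+-} defining the group presentation: it is
   generated by free cancellation and by the relators [x, y] = x^-1 y^-1 x y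
   for x and y adjacent. *)
Inductive raag_eq (V : finType) (e : rel V) :
    seq (letter V) -> seq (letter V) -> Prop :=
| raag_eq_refl u : raag_eq e u u
| raag_eq_sym u v : raag_eq e u v -> raag_eq e v u
| raag_eq_trans u v w : raag_eq e u v -> raag_eq e v w -> raag_eq e u w
| raag_eq_cat u u' v v' :
    raag_eq e u u' -> raag_eq e v v' -> raag_eq e (u ++ v) (u' ++ v')
| raag_eq_cancel a : raag_eq e [:: a; inv_letter a] [::]
| raag_eq_comm x y : e x y ->
    raag_eq e [:: (x, true); (y, true); (x, false); (y, false)] [::].

Section Raag.
Context (V : finType) (e : rel V).
Local Open Scope quotient_scope.

Definition raag_eqb (u v : seq (letter V)) : bool := `[< raag_eq e u v >].

Lemma raag_eqb_refl : reflexive raag_eqb.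
Proof. by move=> u; apply/asboolP/raag_eq_refl. Qed.

Lemma raag_eqb_sym : symmetric raag_eqb.
Proof. by move=> u v; apply/asboolP/asboolP => /raag_eq_sym. Qed.

Lemma raag_eqb_trans : transitive raag_eqb.
Proof.
by move=> v u w /asboolP uv /asboolP vw; apply/asboolP/(raag_eq_trans uv vw).
Qed.

Canonical raag_equiv := EquivRel raag_eqb
  raag_eqb_refl raag_eqb_sym raag_eqb_trans.

Local Notation wrepr := generic_quotient.repr.

Definition raag : Type := {eq_quot raag_equiv}.

HB.instance Definition _ := Choice.on raag.
HB.instance Definition _ := EqQuotient.on raag.

Definition raag_elt (w : seq (letter V)) : raag := \pi_raag w.

Lemma raag_eltP u v : raag_elt u = raag_elt v <-> raag_eq e u v.
Proof.
by split=> [/eqP|uv]; [|apply/eqP]; rewrite /raag_elt eqmodE;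
  [move/asboolP|apply/asboolP].
Qed.

Lemma raag_eltK (g : raag) : raag_elt (wrepr g) = g.
Proof. exact: reprK. Qed.

Definition inv_word (w : seq (letter V)) : seq (letter V) :=
  rev (map (@inv_letter V) w).

Definition raag_one : raag := raag_elt [::].
Definition raag_mul (g h : raag) : raag := raag_elt (wrepr g ++ wrepr h).
Definition raag_inv (g : raag) : raag := raag_elt (inv_word (wrepr g)).

Lemma raag_eltM u v : raag_mul (raag_elt u) (raag_elt v) = raag_elt (u ++ v).
Proof. by apply/raag_eltP/raag_eq_cat; apply/raag_eltP/raag_eltK. Qed.

Lemma raag_mulA : associative raag_mul.
Proof.
move=> g h k; rewrite -(raag_eltK g) -(raag_eltK h) -(raag_eltK k).
by rewrite !raag_eltM catA.
Qed.

Lemma raag_mul1 : left_id raag_one raag_mul.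
Proof. by move=> g; rewrite -(raag_eltK g) raag_eltM. Qed.

Lemma raag_mulr1 : right_id raag_one raag_mul.
Proof. by move=> g; rewrite -(raag_eltK g) raag_eltM cats0. Qed.

Lemma inv_letterK : involutive (@inv_letter V).
Proof. by case=> v b; rewrite /inv_letter /= negbK. Qed.

Lemma inv_wordK : involutive inv_word.
Proof.
by move=> w; rewrite /inv_word map_rev revK -map_comp map_id_in // => a _;
  apply: inv_letterK.
Qed.

Lemma raag_eq_wV w : raag_eq e (w ++ inv_word w) [::].
Proof.
elim: w => [|a w IHw] /=; first exact: raag_eq_refl.
rewrite /inv_word /= rev_cons -cats1 catA -cat1s.
apply: raag_eq_trans (raag_eq_cancel e a).
apply: (@raag_eq_cat _ _ [:: a] [:: a]); first exact: raag_eq_refl.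
exact: (raag_eq_cat IHw (raag_eq_refl _ _)).
Qed.

Lemma raag_mulV : right_inverse raag_one raag_inv raag_mul.
Proof.
move=> g; rewrite /raag_inv -{1}(raag_eltK g) raag_eltM.
exact/raag_eltP/raag_eq_wV.
Qed.

Lemma raag_mulVl : left_inverse raag_one raag_inv raag_mul.
Proof.
move=> g; rewrite /raag_inv -{2}(raag_eltK g) raag_eltM.
by apply/raag_eltP; rewrite -{2}(inv_wordK (wrepr g)); apply: raag_eq_wV.
Qed.

HB.instance Definition _ := isGroup.Build raag
  raag_mulA raag_mul1 raag_mulr1 raag_mulVl raag_mulV.

End Raag.

(* The elements g_1, ..., g_n are an indexed family, so that repetitions
   matter: the orders N r_i are prescribed for each index i. *)
Definition commands (G : groupType) (n : nat) (g : 'I_n -> G) : Prop :=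
  exists2 N : nat, 0 < N &
    forall r : 'I_n -> nat, (forall i, 0 < r i) ->
      exists (Q : finGroupType) (f : {multiplicative G -> Q}),
        forall i, (#[f (g i)])%g = N * r i.

Definition reduced_words (V : finType) (n L : nat) :
    {set n.-tuple (L.-bseq (letter V))} :=
  [set w : n.-tuple (L.-bseq (letter V)) |
    [forall i, freely_reduced (tnth w i)]].

Definition commanded_words (V : finType) (e : rel V) (n L : nat) :
    {set n.-tuple (L.-bseq (letter V))} :=
  [set w : n.-tuple (L.-bseq (letter V)) | (w \in reduced_words V n L) &&
    `[< commands (fun i => raag_elt e (tnth w i)) >]].

(* Probability for the uniform distribution on n-tuples, i.e. for n independent
   uniformly distributed words. *)
Definition command_prob (R : realType) (V : finType) (e : rel V) (n L : nat) :
    R :=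
  (#|commanded_words e n L|%:R / #|reduced_words V n L|%:R)%R.

(* Main.v *)
Require Import Defs.
From HB Require Import structures.
From mathcomp Require Import all_boot all_order all_algebra all_fingroup.
From mathcomp Require Import cyclic.
From mathcomp Require Import all_classical all_reals all_analysis.
From mathcomp Require Import zify ring.
Import numFieldNormedType.Exports.

Set Implicit Arguments.
Unset Strict Implicit.
Unset Printing Implicit Defensive.

Import Order.TTheory GRing.Theory Num.Theory.

(** Write [expo v w] for the exponent sum of the generator v in the word w.
A generic family of words is commanded for reasons that can be read off from
its exponent sums alone, and exponent sums of random reduced words avoid any
prescribed hyperplane with probability tending to 1.

Finite quotients.  It suffices to separate one index at a time: if for each i
there are finite quotients in which g_i has order K_i R, with R arbitrary,
while the orders of the other g_j divide K_i, then the product of these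
quotients, with suitable R's, gives every g_i the order N r_i, where N is the
product of the K_i ([commands_of_separating_quotients]).

The quotients are groups of permutations of Z/p x Z/M of the form
(x, z) |-> (x + chi, z + wt x): a generator shifts the base Z/p and carries
integer weights.  An element with zero shift translates each fibre by an
integer, and this gives orders growing with M; an element with nonzero shift
and p prime permutes the base cyclically, so that its p-th power is the
translation by its total weight.

If the vectors of exponent sums of g_1, ..., g_n are linearly independent, dual
linear forms are used as weights, with chi = 0 ([commands_of_free]).  This is
generic as soon as n <= |V|.

Otherwise there are two non-adjacent vertices a and b, and killing the other
generators leaves a free group, so that chi and wt are unconstrained at a and
b.  Let s_j = (expo a g_j, expo b g_j), suppose that the s_j are pairwise
non-parallel and that expo a g_i != 0.  For chi take the determinant against
s_i modulo a large prime p: it vanishes at g_i and not at the other g_j.  Give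
the edges labelled a over Z/p the weights p [x = 0] - 1, whose sum is 0.  Then
each g_j with j != i has order dividing p, whereas the weight of g_i is
congruent to - expo a g_i modulo p, hence not zero
([commands_of_nonparallel]).

Probability.  Both conditions can be imposed one word at a time, each new word
having to avoid a bounded number of hyperplanes determined by the earlier ones
([generic_commands_cvg1]).  So all that is needed is that a random reduced word
lies in a given hyperplane lam = 0 with probability tending to 0, uniformly in
lam <> 0 ([hyperplane_rare]).  This is clear when |V| = 1, where only the
empty word is on the hyperplane.  With lam v <> 0 and u another vertex, there
are K words of the same length, ending with the same letter, on which lam takes K
distinct values: they differ by the numbers of letters v and v^-1.  Cutting a
word into blocks of that length, some block is one of these K words except with
exponentially small probability; given everything but the choice among the K
words in the first such block, at most one choice lands in the hyperplane.
Hence the probability is at most about 1/K, and K is arbitrary. *)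

(** * Homomorphisms from a right-angled Artin group to finite groups *)

Section WordEval.
Variables (V : finType) (e : rel V) (Q : finGroupType) (q : V -> Q).
Local Open Scope group_scope.

Definition letter_eval (a : letter V) : Q := if a.2 then (q a.1)^-1 else q a.1.

Definition word_eval (w : seq (letter V)) : Q := \prod_(a <- w) letter_eval a.

Lemma word_eval_cons a w : word_eval (a :: w) = letter_eval a * word_eval w.
Proof. exact: big_cons. Qed.

Lemma word_eval_cat u w : word_eval (u ++ w) = word_eval u * word_eval w.
Proof. exact: big_cat. Qed.

Lemma word_eval_raag_eq :
  (forall x y, e x y -> commute (q x) (q y)) ->
  forall u w, raag_eq e u w -> word_eval u = word_eval w.
Proof.
move=> qC u w; elim=> {u w} [//|u w _ ->//|u v w _ -> _ ->//||[v b]|x y exy].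
- by move=> u u' w w' _ IHu _ IHw; rewrite !word_eval_cat IHu IHw.
- rewrite !word_eval_cons /word_eval big_nil /letter_eval /= mulg1.
  by case: b; rewrite /= ?mulVg ?mulgV.
rewrite !word_eval_cons /word_eval big_nil /letter_eval /= mulg1.
by rewrite (qC _ _ exy) !mulgA mulgKV mulVg.
Qed.

Lemma raag_hom_exists : (forall x y, e x y -> commute (q x) (q y)) ->
  exists f : {multiplicative raag e -> Q},
    forall w, f (raag_elt e w) = word_eval w.
Proof.
move=> qC.
pose f (g : raag e) := word_eval (generic_quotient.repr g).
have fE w : f (raag_elt e w) = word_eval w.
  by apply: word_eval_raag_eq => //; apply/raag_eltP/raag_eltK.
have fM : {morph f : g h / g * h}.
  move=> g h; rewrite -(raag_eltK g) -(raag_eltK h) [X in f X]raag_eltM !fE.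
  exact: word_eval_cat.
pose fhom := isMultiplicative.Build (raag e) Q f fM.
by exists (HB.pack_for {multiplicative raag e -> Q} f fhom).
Qed.

End WordEval.

Section Product.
Local Open Scope group_scope.

(** Divisibility of orders, rather than an lcm, is the convenient way to record
that the order in a product of groups is the lcm of the orders of the
components. *)
Lemma product_of_quotients (G : groupType) (I : finType) (Q : I -> finGroupType)
    (f : forall i, {multiplicative G -> Q i}) :
  exists (P : finGroupType) (h : {multiplicative G -> P}),
    forall g k, (#[h g] %| k)%N = [forall i, (#[f i g] %| k)%N].
Proof.
pose P : finGroupType := {dffun forall i, Q i}.
pose h (g : G) : P := [ffun i => f i g].
have hM : {morph h : g g' / g * g'}.
  by move=> g g'; apply/ffunP=> i; rewrite !ffunE gmulfM.
pose hhom := isMultiplicative.Build G P h hM.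
exists P, (HB.pack_for {multiplicative G -> P} h hhom) => g k /=.
have hX j : (h g ^+ j : P) = [ffun i => f i g ^+ j].
  elim: j => [|j IHj]; first by apply/ffunP=> i; rewrite !ffunE.
  by apply/ffunP=> i; rewrite expgS IHj !ffunE expgS.
rewrite order_dvdn hX; apply/eqP/forallP => [hg i|fg].
  by rewrite order_dvdn; move/ffunP: hg => /(_ i); rewrite !ffunE => ->.
by apply/ffunP=> i; rewrite !ffunE; apply/eqP; rewrite -order_dvdn.
Qed.

(** With N the product of the K i, the i-th quotient is chosen with
R = (N / K i) * r i.  In the product of these quotients the order of g j is a
multiple of K j * R = N * r j, and every component of g j has an order dividing
this number, as the K i divide N. *)
Lemma commands_of_separating_quotients (G : groupType) (n : nat)
    (g : 'I_n -> G) :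
  (forall i, exists2 K, 0 < K & forall R, 0 < R ->
     exists (Q : finGroupType) (f : {multiplicative G -> Q}),
       #[f (g i)] = (K * R)%N /\ (forall j, j != i -> #[f (g j)] %| K)%N) ->
  commands g.
Proof.
move=> gP.
have /choice[K KP] i : exists K, 0 < K /\ forall R, 0 < R ->
     exists (Q : finGroupType) (f : {multiplicative G -> Q}),
       #[f (g i)] = (K * R)%N /\ (forall j, j != i -> #[f (g j)] %| K)%N.
  by have [K K0 KP] := gP i; exists K.
pose N := (\prod_i K i)%N.
have KN i : (K i %| N)%N by rewrite /N (bigD1 i) //= dvdn_mulr.
have N_gt0 : 0 < N by apply: prodn_gt0 => i; case: (KP i).
exists N => // r r_gt0.
have /choice[F FP] i : exists F : {Q : finGroupType & {multiplicative G -> Q}},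
    #[projT2 F (g i)] = (N * r i)%N /\
    (forall j, j != i -> #[projT2 F (g j)] %| N)%N.
  have [K0 KR] := KP i.
  have [|Q [f [fi fj]]] := KR (N %/ K i * r i)%N.
    by rewrite muln_gt0 r_gt0 divn_gt0 // dvdn_leq.
  exists (existT _ Q f) => /=; split.
    by rewrite fi mulnA [(K i * _)%N]mulnC divnK.
  by move=> j ji; apply: dvdn_trans (fj j ji) (KN i).
have [P [h hP]] := product_of_quotients (fun i => projT2 (F i)).
exists P, h => j; apply/eqP; rewrite eqn_dvd hP; apply/andP; split.
  apply/forallP => i; have [-> | ji] := eqVneq j i.
    by case: (FP i) => ->.
  by apply: dvdn_trans (dvdn_mulr _ (dvdnn N)); case: (FP i) => _; apply.
by have [<- _] := FP j; have := dvdnn #[h (g j)]; rewrite hP => /forallP.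
Qed.

End Product.

(** * Permutations of Z/p x Z/M given by shifts and weights *)

Section WordVal.
Variables (V : finType).
Local Open Scope ring_scope.

Definition letter_val (A : zmodType) (lam : V -> A) (a : letter V) : A :=
  if a.2 then - lam a.1 else lam a.1.

Definition word_val (A : zmodType) (lam : V -> A) (u : seq (letter V)) : A :=
  \sum_(a <- u) letter_val lam a.

Lemma word_val_cons (A : zmodType) (lam : V -> A) a u :
  word_val lam (a :: u) = letter_val lam a + word_val lam u.
Proof. exact: big_cons. Qed.

Lemma word_val_cat (A : zmodType) (lam : V -> A) u w :
  word_val lam (u ++ w) = word_val lam u + word_val lam w.
Proof. exact: big_cat. Qed.

Lemma word_val_raddf (A B : zmodType) (h : {additive A -> B}) (lam : V -> A) u :
  word_val (h \o lam) u = h (word_val lam u).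
Proof.
rewrite raddf_sum; apply: eq_bigr => a _.
by rewrite /letter_val /=; case: a.2; rewrite ?raddfN.
Qed.

End WordVal.

Section WeightedPerm.
Variables (V : finType) (p' m' : nat).
Local Notation P := 'I_p'.+2.
Local Notation Z := 'I_m'.+2.
Variables (chi : V -> P) (wt : V -> P -> int).
Local Open Scope ring_scope.

(** Z/p is the vertex set of a finite cover of a bouquet of circles, and the
weights of its edges define a further cover with group Z/M. *)
Lemma shear_inj v :
  injective (fun xz : P * Z => (xz.1 + chi v, xz.2 + (wt v xz.1)%:~R)).
Proof.
move=> [x z] [y t] /= xzyt.
have xy : x = y by apply: addIr (congr1 fst xzyt).
move: xzyt; rewrite xy => xzyt; congr (_, _); exact: addIr (congr1 snd xzyt).
Qed.

Definition shear v : {perm P * Z} := perm (@shear_inj v).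

(** The inverse of a generator runs through an edge backwards, starting from
the end point x of an edge whose origin is x - chi v. *)
Definition letter_wt (a : letter V) (x : P) : int :=
  if a.2 then - wt a.1 (x - chi a.1) else wt a.1 x.

Fixpoint word_wt (u : seq (letter V)) (x : P) : int :=
  if u is a :: u' then letter_wt a x + word_wt u' (x + letter_val chi a) else 0.

Lemma letter_evalE a (x : P) (z : Z) :
  letter_eval shear a (x, z) = (x + letter_val chi a, z + (letter_wt a x)%:~R).
Proof.
case: a => v [] /=; rewrite /letter_eval /letter_val /letter_wt /=.
  by apply: (@perm_inj _ (shear v)); rewrite permKV permE /= subrK mulrNz subrK.
by rewrite permE.
Qed.

Lemma word_evalE u (x : P) (z : Z) :
  word_eval shear u (x, z) = (x + word_val chi u, z + (word_wt u x)%:~R).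
Proof.
elim: u x z => [|a u IHu] x z.
  by rewrite /word_eval /word_val !big_nil perm1 /= mulr0z !addr0.
rewrite word_eval_cons permM letter_evalE IHu word_val_cons /=.
by rewrite intrD !addrA.
Qed.

Lemma word_evalXE u k (x : P) (z : Z) :
  (word_eval shear u ^+ k)%g (x, z) =
  (x + word_val chi u *+ k,
   z + (\sum_(i < k) word_wt u (x + word_val chi u *+ i))%:~R).
Proof.
elim: k => [|k IHk]; first by rewrite expg0 perm1 big_ord0 mulr0n mulr0z !addr0.
by rewrite expgSr permM IHk word_evalE big_ord_recr /= intrD mulrSr !addrA.
Qed.

Lemma intr_Zp_eq0 (k : int) : ((k%:~R : Z) == 0) = (m'.+2%:Z %| k)%Z.
Proof.
have -> : ((k%:~R : Z) == 0) = ((`|k|%N%:R : Z) == 0).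
  by case: k => k; rewrite // NegzE mulrNz oppr_eq0.
by rewrite dvdzE /= Zp_nat -val_eqE.
Qed.

Lemma order_word_evalP u k :
  word_val chi u = 0 ->
  reflect (forall x, m'.+2 %| k * `|word_wt u x|%N)%N
          (#[word_eval shear u]%g %| k)%N.
Proof.
move=> u0; rewrite order_dvdn.
have kE x :
    \sum_(i < k) word_wt u (x + word_val chi u *+ i) = word_wt u x *+ k.
  rewrite (eq_bigr (fun=> word_wt u x)) ?sumr_const ?card_ord // => i _.
  by rewrite u0 mul0rn addr0.
apply: (iffP eqP) => [uk x | uk].
  have := congr1 (fun s : {perm _} => s (x, 0)) uk.
  rewrite perm1 word_evalXE kE => /(congr1 snd) /= /eqP.
  by rewrite add0r intr_Zp_eq0 dvdzE /= -mulr_natr abszM mulnC natz.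
apply/permP=> -[x z]; rewrite perm1 word_evalXE kE u0 mul0rn addr0.
congr (_, _); rewrite -[RHS]addr0; congr (_ + _); apply/eqP.
rewrite intr_Zp_eq0 dvdzE /=.
by rewrite -mulr_natr abszM mulnC natz.
Qed.

(** Along a word the weights are added after translations of the base, which
do not change the sum over the base. *)
Lemma sum_word_wt u : (forall v, \sum_x wt v x = 0) -> \sum_x word_wt u x = 0.
Proof.
move=> wt0; elim: u => [|[v b] u IHu] /=; first by rewrite big1.
have tr (F : P -> int) c : \sum_x F (x + c) = \sum_x F x.
  by rewrite (reindex_inj (addIr (- c))); apply: eq_bigr => x _; rewrite subrK.
rewrite big_split /= tr IHu addr0 /letter_wt /=; case: b => //=.
by rewrite sumrN tr wt0 oppr0.
Qed.

(** As p is prime, the p-th power of an element with nonzero shift visits every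
point of the base once, so that it translates the fibres by the total weight,
which is 0. *)
Lemma order_word_eval_shift u :
  prime p'.+2 -> (forall v, \sum_x wt v x = 0) -> word_val chi u != 0 ->
  (#[word_eval shear u]%g %| p'.+2)%N.
Proof.
move=> p_pr wt0 u0; rewrite order_dvdn; apply/eqP/permP=> -[x z].
rewrite perm1 word_evalXE; set s := word_val chi u.
have s_inj : injective (fun i : P => x + s *+ i).
  have s_unit : s \is a GRing.unit.
    have := unitZpE s (isT : (1 < p'.+2)%N); rewrite natr_Zp => ->.
    by rewrite prime_coprime // gtnNdvd ?lt0n.
  move=> i j /addrI; rewrite -[s *+ i]mulr_natr -[s *+ j]mulr_natr.
  by move/(mulrI s_unit); rewrite !natr_Zp.
have -> : s *+ p'.+2 = 0.
  by rewrite -mulr_natr (pchar_Zp (isT : (1 < p'.+2)%N)) mulr0.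
rewrite -(reindex_inj s_inj (P := xpredT) (F := word_wt u)) sum_word_wt //.
by rewrite mulr0z !addr0.
Qed.

End WeightedPerm.

(** * Two sufficient conditions for commanding *)

Section Quotient.
Variables (V : finType) (e : rel V) (p' : nat).
Local Notation P := 'I_p'.+2.
Variables (chi : V -> P) (wt : V -> P -> int).
Local Open Scope ring_scope.

(** Here M = d * p * R, where d is the gcd of the weights of u: the k-th power
of u acts trivially if and only if M divides k times each weight, that is if
and only if p * R divides k. *)
Lemma weighted_quotient (u : seq (letter V)) (x0 : P) (R : nat) :
  (forall x y, e x y -> forall z,
     wt x z + wt y (z + chi x) = wt y z + wt x (z + chi y)) ->
  word_val chi u = 0 -> word_wt chi wt u x0 != 0 -> (0 < R)%N ->
  exists (Q : finGroupType) (f : {multiplicative raag e -> Q}),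
    [/\ #[f (raag_elt e u)]%g = (p'.+2 * R)%N,
        (forall w, prime p'.+2 -> (forall v, \sum_x wt v x = 0) ->
           word_val chi w != 0 -> (#[f (raag_elt e w)]%g %| p'.+2)%N) &
        (forall w, word_val chi w = 0 -> (forall x, word_wt chi wt w x = 0) ->
           (#[f (raag_elt e w)]%g %| p'.+2)%N)].
Proof.
move=> wtC u0 ux0 R_gt0; pose c x := `|word_wt chi wt u x|%N.
pose d := (\big[gcdn/0]_x c x)%N.
have d_dvd x : (d %| c x)%N by apply: biggcdn_inf (dvdnn _).
have d_gt0 : (0 < d)%N.
  by apply: dvdn_gt0 (d_dvd x0); rewrite absz_gt0.
pose M := (d * (p'.+2 * R))%N.
have [m' mE] : exists m', M = m'.+2.
  exists M.-2; suff : (1 < M)%N by case: M => [|[]].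
  by rewrite /M mulnCA -[2%N]muln1 leq_mul // muln_gt0 d_gt0.
pose s := shear m' chi wt.
have sC x y : e x y -> commute (s x) (s y).
  move=> exy; apply/permP=> -[z t]; rewrite !permM !permE /=; congr (_, _).
    by rewrite addrAC.
  by rewrite -!addrA -!intrD wtC.
have [f fE] := raag_hom_exists sC.
exists _, f; split=> [|w p_pr wt0 w0|w w0 wt0]; rewrite fE.
- have sP k := order_word_evalP m' wt k u0; apply/eqP; rewrite eqn_dvd.
  have uE k : (#[word_eval s u]%g %| k)%N = (p'.+2 * R %| k)%N.
    apply/sP/idP => [ck | ck x].
      have : (M %| k * d)%N.
        have -> : (k * d = \big[gcdn/0]_x (k * c x))%N.
          exact: (big_morph (muln k) (muln_gcdr k) (muln0 k)).
        by apply: (introT (dvdn_biggcdP _ _ _)) => x _; rewrite mE; apply: ck.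
      by rewrite /M [(k * d)%N]mulnC dvdn_pmul2l.
    rewrite -mE /M mulnC; apply: dvdn_mul => //; exact: d_dvd.
  by rewrite uE dvdnn -uE dvdnn.
- exact: order_word_eval_shift.
- by apply/order_word_evalP => // x; rewrite wt0 muln0 dvdn0.
Qed.

End Quotient.

Section CommandsRaag.
Variables (V : finType) (e : rel V) (n : nat) (u : 'I_n -> seq (letter V)).
Local Open Scope ring_scope.

Lemma word_wt_const (p' : nat) (phi : V -> int) w (x : 'I_p'.+2) :
  word_wt (fun=> 0) (fun v _ => phi v) w x = word_val phi w.
Proof.
elim: w x => [|[v b] w IHw] x /=; first by rewrite /word_val big_nil.
by rewrite word_val_cons IHw.
Qed.

(** With zero shifts and weights that are constant on the base, a word
translates all the fibres by the value of the form. *)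
Lemma commands_of_dual_forms (phi : 'I_n -> V -> int) :
  (forall i, word_val (phi i) (u i) != 0) ->
  (forall i j, i != j -> word_val (phi i) (u j) = 0) ->
  commands (fun i => raag_elt e (u i)).
Proof.
move=> phi_i phi_j; apply: commands_of_separating_quotients => i.
exists 2%N => // R R_gt0.
have chi0 w : word_val (fun=> 0 : 'I_2) w = 0.
  by apply: big1 => a _; rewrite /letter_val oppr0 if_same.
have [||||Q [f [fi _ fj]]] := @weighted_quotient V e 0 (fun=> 0)
  (fun v _ => phi i v) (u i) 0 R => //.
- by move=> x y _ z; rewrite addrC.
- by rewrite word_wt_const.
exists Q, f; split=> // j ji; apply: fj => // x.
by rewrite word_wt_const phi_j // eq_sym.
Qed.

Definition expo (v : V) : seq (letter V) -> int :=
  word_val (fun x => (x == v)%:Z).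

Lemma word_val_expo (a b : V) (k l : int) w :
  word_val (fun v => k * (v == a)%:Z - l * (v == b)%:Z) w =
  k * expo a w - l * expo b w.
Proof.
rewrite /expo /word_val !mulr_sumr -sumrB; apply: eq_bigr => -[v []] _ //.
by rewrite /letter_val /= opprB !mulrN opprK addrC.
Qed.

(** See the opening comment.  The shift is lam modulo p, where lam is the
determinant against the exponent vector (X i, Y i) of u i. *)
Lemma commands_of_nonparallel (a b : V) :
  a != b -> ~~ e a b -> ~~ e b a ->
  (forall i, expo a (u i) != 0) ->
  (forall i j, i != j ->
     expo a (u i) * expo b (u j) != expo a (u j) * expo b (u i)) ->
  commands (fun i => raag_elt e (u i)).
Proof.
move=> ab eab eba ua_neq0 uNpar; apply: commands_of_separating_quotients => i.
pose X j := expo a (u j); pose Y j := expo b (u j).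
pose lam v : int := Y i * (v == a)%:Z - X i * (v == b)%:Z.
have lamE j : word_val lam (u j) = Y i * X j - X i * Y j.
  exact: word_val_expo.
(* Any prime above B keeps X i and the nonzero values of lam nonzero mod p. *)
pose B := (`|X i| + \sum_j `|word_val lam (u j)|)%N.
have [p ltBp p_pr] := prime_above B.
have [p' pE] : exists p', p = p'.+2.
  by exists p.-2; case: p p_pr {ltBp} => [|[]].
rewrite {p}pE in ltBp p_pr.
have intr_neq0 (k : int) : k != 0 -> (`|k| <= B)%N -> (k%:~R : 'I_p'.+2) != 0.
  move=> k0 kB; rewrite intr_Zp_eq0 dvdzE /=; apply/negP => /dvdn_leq.
  by rewrite absz_gt0 k0 leqNgt (leq_ltn_trans kB) // => /(_ isT).
pose chi v : 'I_p'.+2 := (lam v)%:~R.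
have chiE w : word_val chi w = (word_val lam w)%:~R.
  exact: (word_val_raddf (intmul (1 : 'I_p'.+2))).
pose wt v (x : 'I_p'.+2) : int := (v == a)%:Z * (p'.+2%:Z * (x == 0)%:Z - 1).
have wt_sum0 v : \sum_x wt v x = 0.
  rewrite -mulr_sumr sumrB -mulr_sumr (bigD1 0) //= big1 => [|x /negbTE -> //].
  by rewrite addr0 sumr_const card_ord /= mulr1 natz subrr mulr0.
(* All the weights of a are -1 mod p, whatever the base point. *)
have wt_mod w x : (p'.+2%:Z %| word_wt chi wt w x + expo a w)%Z.
  elim: w x => [|[v c] w IHw] x /=; first by rewrite /expo /word_val big_nil.
  rewrite /expo word_val_cons addrACA rpredDr ?IHw //.
  rewrite /letter_wt /letter_val /wt /=.
  case: c; case: (v == a); rewrite ?mul0r ?mul1r ?oppr0 ?addr0 ?dvdz0 //.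
    by rewrite opprB addrAC subrr sub0r rpredN dvdz_mulr.
  by rewrite subrK dvdz_mulr.
exists p'.+2 => // R R_gt0.
have [||||Q [f [fi fj _]]] := @weighted_quotient V e p' chi wt (u i) 0 R => //.
- move=> x y exy z; rewrite /wt /chi /lam.
  have [xa | xa] := eqVneq x a; have [ya | ya] := eqVneq y a.
  + by rewrite xa ya.
  + have -> : (y == b) = false.
      by apply: contraNF eab => /eqP <-; rewrite -xa.
    by rewrite !(mulr0, mul0r) subr0 mulr0z !addr0 add0r.
  + have -> : (x == b) = false.
      by apply: contraNF eba => /eqP <-; rewrite -ya.
    by rewrite !(mulr0, mul0r) subr0 mulr0z !addr0 add0r.
  + by rewrite !mul0r.
- by rewrite chiE lamE mulrC subrr mulr0z.
- apply: contraNneq (intr_neq0 _ (ua_neq0 i) _) => [wt0|].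
    by rewrite intr_Zp_eq0 -[expo a _]add0r -wt0.
  by rewrite leq_addr.
exists Q, f; split=> // j ji; apply: fj => //; rewrite chiE; apply: intr_neq0.
  by rewrite lamE subr_eq0 [Y i * _]mulrC eq_sym uNpar // eq_sym.
by rewrite /B (bigD1 j) //= addnCA leq_addr.
Qed.

End CommandsRaag.

(** * Reduced words extending a given letter *)

Section Continuations.
Variable V : finType.
Local Notation rel_red := (fun a b : letter V => b != inv_letter a).

(** The words w of length l such that p :: w is freely reduced.  Lists make the
recursion on the length and the concatenation of blocks transparent. *)
Fixpoint continuations (l : nat) (p : letter V) : seq (seq (letter V)) :=
  if l is l'.+1 then
    flatten [seq [seq a :: w | w <- continuations l' a] |
              a <- rem (inv_letter p) (enum {: letter V})]
  else [:: [::]].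

Local Notation D := (#|V|.*2.-1).

Lemma mem_rem_enum (p a : letter V) :
  (a \in rem p (enum {: letter V})) = (a != p).
Proof. by rewrite mem_rem_uniq ?enum_uniq // !inE mem_enum andbT. Qed.

Lemma mem_continuations l p w :
  (w \in continuations l p) = (size w == l) && path rel_red p w.
Proof.
elim: l p w => [|l IHl] p [|a w] //=.
  by apply/flatten_mapP => -[b _ /mapP[]].
apply/flatten_mapP/idP => [[b] | /and3P[wl ap pw]].
  rewrite mem_rem_enum => bp /mapP[w' w'l [-> ->]].
  by rewrite eqSS bp; move: w'l; rewrite IHl.
exists a; first by rewrite mem_rem_enum.
by apply: map_f; rewrite IHl pw andbT.
Qed.

Lemma size_continuations l p : size (continuations l p) = D ^ l.
Proof.
elim: l p => [|l IHl] p //; rewrite /= size_flatten sumnE !big_map.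
rewrite (eq_bigr (fun=> D ^ l)) => [|a _]; last by rewrite size_map IHl.
rewrite big_const_seq count_predT iter_addn_0 size_rem ?mem_enum // -cardE.
by rewrite card_prod card_bool muln2 mulnC expnS.
Qed.

Lemma continuations_uniq l p : uniq (continuations l p).
Proof.
elim: l p => [|l IHl] p //=; apply: allpairs_uniq_dep => /=.
- by rewrite rem_uniq ?enum_uniq.
- by move=> a _; apply: IHl.
- by move=> [a w] [b w'] _ _ /= [-> ->].
Qed.

Lemma count_continuationsS (P : pred (seq (letter V))) l p :
  count P (continuations l.+1 p) =
  \sum_(a <- rem (inv_letter p) (enum {: letter V}))
     count (fun w => P (a :: w)) (continuations l a).
Proof.
rewrite /= count_flatten sumnE big_map big_map; apply: eq_bigr => a _.
by rewrite count_map.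
Qed.

Lemma count_continuationsD (P : pred (seq (letter V))) k l p :
  count P (continuations (k + l) p) =
  \sum_(u <- continuations k p)
     count (fun w => P (u ++ w)) (continuations l (last p u)).
Proof.
elim: k P p => [|k IHk] P p; first by rewrite /= big_seq1.
rewrite addSn count_continuationsS big_flatten big_map; apply: eq_bigr => a _.
by rewrite big_map IHk.
Qed.

End Continuations.

Section SpreadWords.
Variables (V : finType) (v u : V).
Hypothesis uv : u != v.
Local Notation D := (#|V|.*2.-1).
Variable K : nat.

(** The words u^(+-1) v^(j+1) u v^-(K-j) u for j < K, which can follow the
letter p thanks to the choice of the first sign.  They have the same length
K + 4 and the same last letter, and a linear form that does not vanish at v
takes different values on them. *)
Definition spread_word (p : letter V) (j : nat) : seq (letter V) :=
  (u, p == (u, true)) :: nseq j.+1 (v, false) ++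
  (u, false) :: nseq (K - j) (v, true) ++ [:: (u, false)].

Lemma path_nseq_cat (p a : letter V) k w :
  path (fun a b => b != inv_letter a) p (nseq k.+1 a ++ w) =
  (a != inv_letter p) && path (fun a b => b != inv_letter a) a w.
Proof.
have aa : a != inv_letter a.
  by case: a => x b; rewrite /inv_letter xpair_eqE /= eqxx; case: b.
by elim: k p => [//|k IHk] p; move: (IHk a) => /= ->; rewrite aa.
Qed.

Lemma spread_word_continuation p j :
  j < K -> spread_word p j \in continuations (K + 4) p.
Proof.
move=> jK; rewrite mem_continuations /spread_word; apply/andP; split.
  rewrite /= size_cat /= size_cat !size_nseq /=.
  by apply/eqP; lia.
have pathS (q a : letter V) w : path (fun a b => b != inv_letter a) q (a :: w) =
  (a != inv_letter q) && path (fun a b => b != inv_letter a) a w by [].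
rewrite pathS path_nseq_cat pathS -(subnSK jK) path_nseq_cat pathS /=.
rewrite /inv_letter /= !xpair_eqE /= (negbTE uv) [v == u]eq_sym (negbTE uv) /=.
rewrite !andbT.
by case: p => x b /=; rewrite !xpair_eqE negb_and; case: b; case: eqVneq.
Qed.

Lemma last_spread_word p j : last p (spread_word p j) = (u, false).
Proof. by rewrite /spread_word /= last_cat /= last_cat. Qed.

Lemma word_val_spread_word (A : comRingType) (lam : V -> A) p j : j <= K ->
  word_val lam (spread_word p j) =
  (letter_val lam (u, p == (u, true)) + lam u *+ 2 + lam v - lam v *+ K
     + lam v *+ j.*2)%R.
Proof.
move=> jK; have valn (c : letter V) k :
    word_val lam (nseq k c) = (letter_val lam c *+ k)%R.
  by rewrite /word_val big_nseq iter_addr_0.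
rewrite /spread_word word_val_cons word_val_cat valn.
rewrite word_val_cons word_val_cat valn.
rewrite /word_val big_seq1 /letter_val /= mulrnBr // -mul2n; ring.
Qed.

End SpreadWords.

(** * Anti-concentration of linear forms on reduced words *)

Lemma expn_dominates (K q Q : nat) : q < Q ->
  exists M0, forall M, M0 <= M -> K * q ^ M <= Q ^ M.
Proof.
case: q => [|q] qQ.
  by exists 1 => -[|M] // _; rewrite exp0n // muln0.
have grow M : (M + q.+1) * q.+1 ^ M <= q.+1 * Q ^ M.
  elim: M => [|M IHM]; first by rewrite !expn0.
  rewrite !expnS; apply: (@leq_trans (q.+2 * (q.+1 * Q ^ M))); last first.
    by rewrite mulnCA leq_mul // leq_mul.
  apply: leq_trans (leq_mul (leqnn _) IHM); rewrite mulnA mulnA leq_mul //; lia.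
exists (K * q.+1) => M KM; rewrite -(leq_pmul2l (ltn0Sn q)) mulnCA mulnA.
by apply: leq_trans (grow M); rewrite leq_mul // (leq_trans KM) ?leq_addr.
Qed.

Lemma count_le1 (T : eqType) (P : pred T) (s : seq T) :
  uniq s -> {in s &, forall x y, P x -> P y -> x = y} -> count P s <= 1.
Proof.
move=> s_uniq Ps; rewrite -size_filter; have := filter_uniq P s_uniq.
case def_s': (seq.filter P s) => [|x [|y s']] //= /andP[/negP[]].
have /andP[Px xs] : P x && (x \in s) by rewrite -mem_filter def_s' mem_head.
have /andP[Py ys] : P y && (y \in s).
  by rewrite -mem_filter def_s' !inE eqxx orbT.
by rewrite (Ps _ _ xs ys Px Py) mem_head.
Qed.

Section Concentration.
Variables (V : finType) (v u : V).
Hypothesis uv : u != v.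
Variables (A : numDomainType) (lam : V -> A).
Hypothesis lamv : lam v != 0%R.
Local Notation D := (#|V|.*2.-1).
Variable K : nat.

Definition fiber_count (l : nat) (p : letter V) (c : A) : nat :=
  count (fun w => word_val lam w == c) (continuations l p).

Lemma spread_word_val_inj p j k : j <= K -> k <= K ->
  word_val lam (spread_word v u K p j) = word_val lam (spread_word v u K p k) ->
  j = k.
Proof.
move=> jK kK; rewrite !word_val_spread_word // => /addrI.
by move=> /(mulrIn lamv)/double_inj.
Qed.

(** Split the words according to their first K + 4 letters.  The K blocks given
by the spread words are followed by the same words, which have to take K
different values: altogether they contribute at most one word for each
continuation.  The other blocks are bounded by the hypothesis. *)
Lemma fiber_step l X p c :
  (forall q c', K * fiber_count l q c' <= X) ->
  K * fiber_count (K + 4 + l) p c <= K * D ^ l + (D ^ (K + 4) - K) * X.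
Proof.
move=> fX; rewrite /fiber_count count_continuationsD.
pose pats := [seq spread_word v u K p j | j <- iota 0 K].
have pats_uniq : uniq pats.
  rewrite map_inj_in_uniq ?iota_uniq // => j k; rewrite !mem_iota !add0n /=.
  by move=> jK kK jk; apply: (@spread_word_val_inj p); rewrite ?jk // ltnW.
have pats_sub : {subset pats <= continuations (K + 4) p}.
  move=> x; rewrite /pats => /mapP[j]; rewrite mem_iota add0n /= => jK ->.
  exact: spread_word_continuation.
have pats_perm : perm_eq [seq x <- continuations (K + 4) p | x \in pats] pats.
  apply: uniq_perm => //; first by rewrite filter_uniq ?continuations_uniq.
  by move=> x; rewrite mem_filter andb_idr //; apply: pats_sub.
have pats_size : count (mem pats) (continuations (K + 4) p) = K.
  by rewrite -size_filter (perm_size pats_perm) size_map size_iota.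
rewrite (bigID (mem pats)) /= mulnDr; apply: leq_add.
  rewrite leq_mul // -big_filter (perm_big _ pats_perm) big_map.
  under eq_bigr => j _ do rewrite last_spread_word -sum1_count big_mkcond.
  rewrite exchange_big -(size_continuations l (u, false)) -sum1_size.
  apply: leq_sum => w _; rewrite -big_mkcond sum1_count.
  apply: count_le1 (iota_uniq _ _) _ => j k.
  rewrite !mem_iota !add0n => /andP[_ jK] /andP[_ kK] /eqP + /eqP.
  rewrite !word_val_cat => <- /addIr kj.
  by apply/esym/(spread_word_val_inj _ _ kj); apply: ltnW.
rewrite big_distrr /=.
apply: (@leq_trans (\sum_(x <- continuations (K + 4) p | x \notin pats) X)).
  apply: leq_sum => x _.
  apply: leq_trans (fX (last p x) (c - word_val lam x)%R).
  rewrite leq_mul //; apply/eq_leq/eq_count => w.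
  by rewrite word_val_cat addrC eq_sym -subr_eq eq_sym.
rewrite big_const_seq iter_addn_0 mulnC leq_mul2r; apply/orP; right.
have := count_predC (mem pats) (continuations (K + 4) p).
by rewrite pats_size size_continuations => <-; rewrite addKn.
Qed.

End Concentration.

Section FiberBound.
Variable V : finType.
Hypothesis V_gt1 : 1 < #|V|.
Local Notation D := (#|V|.*2.-1).
Variable K : nat.

Lemma card_letters_gt2 : 2 < D.
Proof. by lia. Qed.

Lemma spread_words_lt : K < D ^ (K + 4).
Proof.
have D_gt1 : 1 < D by apply: ltnW card_letters_gt2.
by apply: (leq_trans (ltn_expl K D_gt1)); rewrite leq_exp2l ?leq_addr.
Qed.

(** The second term counts words none of whose M blocks is a spread word: it is
exponentially smaller than the first one. *)
Lemma fiber_bound (A : numDomainType) (lam : V -> A) v M r p c :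
  lam v != 0%R ->
  K * fiber_count lam (M * (K + 4) + r) p c <=
    D ^ (M * (K + 4) + r) + (D ^ (K + 4) - K) ^ M * (K * D ^ r).
Proof.
move=> lamv; have [u uv] : exists u, u != v.
  have /card_gt1P[x [y [_ _ xy]]] := V_gt1.
  by have [<- | xv] := eqVneq x v; [exists y; rewrite eq_sym | exists x].
elim: M p c => [|M IHM] p c.
  rewrite mul0n add0n expn0 mul1n; apply: leq_trans (leq_addl _ _).
  by rewrite leq_mul // -(size_continuations r p) count_size.
rewrite mulSn -addnA; apply: leq_trans (fiber_step uv lamv p c IHM) _.
rewrite expnS -!mulnA; set l := M * _ + r; set Y := _ ^ M * _.
by rewrite mulnDr addnA -mulnDl subnKC ?(ltnW spread_words_lt) // -expnD.
Qed.

Lemma fiber_eventually :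
  exists l0, forall (A : numDomainType) (lam : V -> A) v l p c, lam v != 0%R ->
    l0 <= l -> K * fiber_count lam l p c <= 2 * D ^ l.
Proof.
have D_gt0 : 0 < D by apply: ltn_trans card_letters_gt2.
have [K0 | K_gt0] := posnP K; first by exists 0 => *; rewrite K0.
have [|M0 M0P] := @expn_dominates K (D ^ (K + 4) - K) (D ^ (K + 4)).
  by rewrite ltn_subrL K_gt0 expn_gt0 D_gt0.
exists (M0 * (K + 4)) => A lam v l p c lamv l_ge.
have KB : 0 < K + 4 by rewrite addn4.
rewrite (divn_eq l (K + 4)); set M := l %/ _; set r := l %% _.
apply: leq_trans (fiber_bound M r p c lamv) _; rewrite mulSn mul1n leq_add2l.
rewrite mulnA [leqRHS]expnD leq_mul // mulnC [M * _]mulnC expnM M0P //.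
by rewrite leq_divRL.
Qed.

End FiberBound.

Section ReducedWords.
Variable V : finType.
Local Notation D := (#|V|.*2.-1).

Definition bounded_reduced (L : nat) : {set L.-bseq (letter V)} :=
  [set w : L.-bseq (letter V) | freely_reduced w].

Lemma card_reduced_count L (P : pred (seq (letter V))) :
  #|[set w in bounded_reduced L | P w]| =
  P [::] + \sum_(l < L) \sum_(a : letter V)
              count (fun w => P (a :: w)) (continuations l a).
Proof.
pose I := [seq (l, a) | l <- iota 0 L, a <- enum {: letter V}].
pose S := [::] :: [seq la.2 :: w | la <- I, w <- continuations la.1 la.2].
have S_uniq : uniq S.
  rewrite /S cons_uniq; apply/andP; split.
    by apply/negP => /allpairsPdep[la [w []]].
  apply: allpairs_uniq_dep => [||x y].
  - by apply: allpairs_uniq; rewrite ?iota_uniq ?enum_uniq // => -[? ?] [].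
  - by move=> la _; apply: continuations_uniq.
  move=> /allpairsPdep[[l a] [w [_ lw ->]]].
  move=> /allpairsPdep[[m b] [w' [_ mw' ->]]]; move: lw mw'; rewrite /=.
  rewrite !mem_continuations => /andP[/eqP <- _] /andP[/eqP <- _].
  by case=> -> ->.
have memS w : (w \in S) = (size w <= L) && freely_reduced w.
  rewrite /S inE; case: w => [|a w] //=.
  apply/allpairsPdep/andP.
    move=> [[l b] [w' [/allpairsPdep[m [c [mL _ [-> ->]]]]]]].
    rewrite /= mem_continuations => /andP[/eqP sz wp] [-> ->]; split=> //.
    by move: mL; rewrite mem_iota sz.
  move=> [wL wp]; exists (size w, a), w; split=> //.
    apply/allpairsPdep; exists (size w), a; split=> //.
      by rewrite mem_iota.
    by rewrite mem_enum.
  by rewrite mem_continuations eqxx.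
have -> : #|[set w in bounded_reduced L | P w]| = count P S.
  rewrite cardE -(size_map (fun w : L.-bseq _ => val w)) -size_filter.
  apply/perm_size/uniq_perm.
  - by rewrite map_inj_uniq ?enum_uniq //; apply: val_inj.
  - by rewrite filter_uniq.
  move=> w; rewrite mem_filter memS; apply/mapP/and3P => [[w'] | [Pw wL rw]].
    by rewrite mem_enum !inE => /andP[rw Pw] ->; rewrite size_bseq.
  by exists (Bseq wL) => //; rewrite mem_enum !inE /= rw.
rewrite /S /= count_flatten sumnE big_map; congr (_ + _).
rewrite big_map big_allpairs_dep /=.
pose F l := \sum_a count (fun w => P (a :: w)) (continuations l a).
rewrite -(big_mkord xpredT F).
rewrite /index_iota subn0; apply: eq_bigr => l _; rewrite big_enum /=.
by apply: eq_bigr => a _; rewrite count_map.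
Qed.

End ReducedWords.

Section HyperplaneRare.
Variable V : finType.
Local Notation D := (#|V|.*2.-1).

Lemma card_bounded_reduced L :
  #|bounded_reduced V L| = 1 + \sum_(l < L) \sum_(a : letter V) D ^ l.
Proof.
have -> : bounded_reduced V L =
    [set w in bounded_reduced V L | predT (w : seq _)].
  by apply/setP=> w; rewrite !inE andbT.
rewrite card_reduced_count; congr (_ + _); apply: eq_bigr => l _.
by apply: eq_bigr => a _; rewrite -(size_continuations l a) -count_predT.
Qed.

Lemma bounded_reduced_gt L : 0 < #|V| -> L < #|bounded_reduced V L|.
Proof.
move=> V_gt0; rewrite card_bounded_reduced add1n ltnS.
rewrite -[leqLHS]card_ord -sum1_card; apply: leq_sum => l _.
rewrite sum_nat_const muln_gt0 expn_gt0 card_prod card_bool muln2; lia.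
Qed.

(** A freely reduced word in one generator is a power of a letter. *)
Lemma rank1_word_val_eq0 (A : numDomainType) (lam : V -> A) v w :
  #|V| <= 1 -> lam v != 0%R -> freely_reduced w ->
  (word_val lam w == 0%R) = (w == [::]).
Proof.
move=> /card_le1_eqP V1 lamv; case: w => [|a w] wp.
  by rewrite /word_val big_nil !eqxx.
have -> : a :: w = nseq (size w).+1 a.
  congr cons; move: wp; rewrite /freely_reduced /=.
  elim: w a => [//|b w IHw] a /= /andP[ab /IHw ->]; rewrite size_nseq /=.
  suff -> : b = a by [].
  move: ab; case: a b {IHw} => x c [y d]; rewrite (V1 x y) // /inv_letter.
  by rewrite xpair_eqE /= eqxx /=; case: c d => [] [].
rewrite /word_val big_nseq iter_addr_0 mulrn_eq0 /= /letter_val (V1 v a.1) //.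
by case: a.2; rewrite ?oppr_eq0 (negbTE lamv).
Qed.

(** The proportion tends to 0 uniformly in the linear form.  In rank one only
the empty word has value 0; otherwise short words, to which the bound on the
fibres does not apply, are negligible among all words of length at most L. *)
Lemma hyperplane_rare (K : nat) :
  exists L0, forall L, L0 <= L ->
    forall (A : numDomainType) (lam : V -> A) v, lam v != 0%R ->
    K * #|[set w in bounded_reduced V L | word_val lam w == 0%R]|
      <= #|bounded_reduced V L|.
Proof.
have [V_le1 | V_gt1] := leqP #|V| 1.
  exists K => L KL A lam v lamv.
  have V_gt0 : 0 < #|V| by apply/card_gt0P; exists v.
  apply: leq_trans (bounded_reduced_gt L V_gt0); apply: leqW.
  apply: leq_trans KL; rewrite -[leqRHS]muln1 leq_mul //.
  rewrite -(cards1 ([bseq] : L.-bseq (letter V))).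
  apply/subset_leq_card/fintype.subsetP => w.
  by rewrite !inE => /andP[rw]; rewrite (rank1_word_val_eq0 V_le1 lamv).
(* The factor 4 absorbs the constant 2 of the fibre bound and the error C. *)
have [l0 l0P] := fiber_eventually V_gt1 (4 * K).
pose C := 4 * K * #|bounded_reduced V l0|.
exists (maxn C l0) => L; rewrite geq_max => /andP[CL lL] A lam v lamv.
have CS : C <= #|bounded_reduced V L|.
  by apply: leq_trans CL (ltnW (bounded_reduced_gt L (ltnW V_gt1))).
rewrite -(@leq_pmul2l 4) // mulnA.
apply: (@leq_trans (C + 2 * #|bounded_reduced V L|)); last by lia.
rewrite (card_reduced_count L (fun w => word_val lam w == 0%R)) mulnDr.
rewrite /C !card_bounded_reduced mulnDr -addnA leq_add //.
  by rewrite leq_mul // leq_b1.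
rewrite [2 * _]mulnDr addnCA; apply: leq_trans (leq_addl _ _).
pose F l := \sum_(a : letter V) D ^ l.
have -> : \sum_(l < l0) F l = \sum_(l < L) if l < l0 then F l else 0.
  by rewrite (big_ord_widen L F) // big_mkcond.
rewrite !big_distrr -big_split /=; apply: leq_sum => l _.
have [ll0 | l0l] := ltnP l l0.
  apply: leq_trans (leq_addr _ _); rewrite leq_mul //; apply: leq_sum => a _.
  by rewrite -(size_continuations l a) count_size.
rewrite muln0 add0n !big_distrr; apply: leq_sum => a _ /=.
apply: leq_trans (l0P A lam v l a (- letter_val lam a)%R lamv l0l).
rewrite leq_mul //; apply/eq_leq/eq_count => w.
by rewrite word_val_cons addrC addr_eq0.
Qed.

End HyperplaneRare.

Section GoodTuples.
Variables (T : finType) (S : {set T}) (bad : seq T -> pred T).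

(** Tuples chosen one entry at a time, the last entry first, each entry avoiding
a set that depends on the entries chosen before. *)
Fixpoint good (t : seq T) : bool :=
  if t is x :: t' then [&& x \in S, ~~ bad t' x & good t'] else true.

Lemma card_good_cons n :
  #|[set t : n.+1.-tuple T | good t]| =
  \sum_(t : n.-tuple T | good t) #|[set x in S | ~~ bad t x]|.
Proof.
rewrite -sum1_card.
pose h (xt : n.-tuple T * T) : n.+1.-tuple T := [tuple of xt.2 :: xt.1].
rewrite (reindex h) /=; last first.
  exists (fun t : n.+1.-tuple T => ([tuple of behead t], thead t)).
    move=> [t x] _.
    by rewrite /h /= theadE; congr (_, _); apply: val_inj.
  by move=> t _; rewrite /h /= [RHS]tuple_eta.
under [RHS]eq_bigr => t _ do rewrite -sum1_card.
rewrite pair_big_dep /=; apply: eq_bigl => -[t x].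
by rewrite !inE /= andbA andbC.
Qed.

Lemma card_good_le n : #|[set t : n.-tuple T | good t]| <= #|S| ^ n.
Proof.
elim: n => [|n IHn]; first by rewrite (leq_trans (max_card _)) ?card_tuple.
rewrite card_good_cons expnSr; apply: leq_trans (leq_mul IHn (leqnn #|S|)).
rewrite -[X in _ <= X * _]sum1dep_card.
rewrite big_distrl /=; apply: leq_sum => t _; rewrite mul1n.
by apply/subset_leq_card/fintype.subsetP => x; rewrite inE => /andP[].
Qed.

(** Each entry is bad with probability at most 1/K, so a tuple of n entries
fails to be good with probability at most n/K. *)
Lemma card_good (K n : nat) :
  (forall t, size t < n -> good t -> K * #|[set x in S | bad t x]| <= #|S|) ->
  K * #|S| ^ n <= n * #|S| ^ n + K * #|[set t : n.-tuple T | good t]|.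
Proof.
elim: n => [|n IHn] badS.
  rewrite expn0 mul0n add0n leq_mul //; apply/card_gt0P.
  by exists [tuple]; rewrite inE.
have {}IHn := IHn (fun t tn => badS t (ltnW tn)).
have := card_good_le n; have := card_good_cons n.
set g' := #|[set t : n.+1.-tuple T | good t]| => g'E.
set g := #|[set t : n.-tuple T | good t]| in IHn * => g_le.
have gS : K * (g * #|S|) <= K * g' + g * #|S|.
  rewrite g'E /g -sum1dep_card.
  rewrite !big_distrl !big_distrr -big_split /=.
  apply: leq_sum => t t_good; rewrite !mul1n.
  have := badS t; rewrite size_tuple ltnSn => /(_ isT t_good) bad_t.
  rewrite -{1}(cardsID [set x | bad t x] S) mulnDr addnC leq_add //.
    rewrite leq_mul //; apply/subset_leq_card/fintype.subsetP => x.
    by rewrite !inE => /andP[-> ->].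
  apply: leq_trans bad_t; rewrite leq_mul //.
  by apply/subset_leq_card/fintype.subsetP => x; rewrite !inE.
rewrite !expnS; move: (#|S|) (#|S| ^ n) gS IHn g_le => s sn gS IHn g_le.
have := leq_mul IHn (leqnn s); have := leq_mul g_le (leqnn s); nia.
Qed.

End GoodTuples.

(** * From counting to the limit *)

Section Limit.
Variables (V : finType) (e : rel V).

Lemma card_reduced_words n L :
  #|reduced_words V n L| = #|bounded_reduced V L| ^ n.
Proof.
pose B := L.-bseq (letter V); pose S := bounded_reduced V L.
pose no_bad (t : seq B) := pred0 : pred B.
have goodE t : good S no_bad t = all (mem S) t.
  by elim: t => //= x t ->.
have -> : reduced_words V n L = [set t : n.-tuple _ | good S no_bad t].
  apply/setP=> t; rewrite !inE goodE; apply/forallP/all_tnthP => tS i.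
    by rewrite /= inE.
  by have := tS i; rewrite /= inE.
elim: n => [|n IHn].
  rewrite expn0; apply/eqP.
  rewrite eqn_leq (leq_trans (max_card _)) ?card_tuple //=.
  by apply/card_gt0P; exists [tuple]; rewrite inE.
rewrite card_good_cons expnSr -IHn -[X in X * _]sum1dep_card big_distrl /=.
apply: eq_bigr => t _; rewrite mul1n; congr #|pred_of_set _|.
by apply/setP=> x; rewrite inE andbT.
Qed.

Lemma bounded_reduced_gt0 L : 0 < #|bounded_reduced V L|.
Proof. by rewrite card_bounded_reduced. Qed.

Lemma command_prob_cvg1 (R : realType) n :
  (forall K, exists L0, forall L, L0 <= L ->
     K * #|bounded_reduced V L| ^ n
       <= n * #|bounded_reduced V L| ^ n + K * #|commanded_words e n L|) ->
  (command_prob R e n L @[L --> \oo] --> (1 : R)%R)%classic.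
Proof.
move=> KP; apply/cvgrPdist_lt => eps eps_gt0.
pose K := (Num.truncn (n%:R / eps : R)%R).+1.
have KE : (n%:R < K%:R * eps)%R.
  by rewrite -ltr_pdivrMr // truncnS_gt.
have [L0 L0P] := KP K; exists L0 => // L /= LL0.
have {L0P} := L0P L LL0; rewrite -card_reduced_words /command_prob.
have Rn_gt0 : 0 < #|reduced_words V n L|.
  by rewrite card_reduced_words expn_gt0 bounded_reduced_gt0.
have CR : #|commanded_words e n L| <= #|reduced_words V n L|.
  by apply/subset_leq_card/fintype.subsetP => w; rewrite inE => /andP[].
move: Rn_gt0 CR; set r := #|reduced_words V n L|.
set c := #|commanded_words e n L| => r_gt0 cr KR.
have rR : (0 < r%:R :> R)%R by rewrite ltr0n.
rewrite ger0_norm; last by rewrite subr_ge0 ler_pdivrMr // mul1r ler_nat.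
rewrite ltrBlDr -ltrBlDl ltr_pdivlMr // mulrBl mul1r ltrBlDr.
rewrite -(@ltr_pM2l _ K%:R) // mulrDr.
have : (K%:R * r%:R <= n%:R * r%:R + K%:R * c%:R :> R)%R.
  by rewrite -!natrM -natrD ler_nat.
move=> /le_lt_trans; apply; rewrite addrC ltrD2l mulrA ltr_pM2r //.
Qed.

End Limit.

Section SequentialChoice.
Variables (V : finType) (e : rel V) (A : numDomainType).
Variable forms : seq (seq (letter V)) -> seq {ffun V -> A}.

(** [forms t] is the finite list of linear forms that must not vanish on a word
added to the family t. *)
Definition avoids (t : seq (seq (letter V))) (w : seq (letter V)) : bool :=
  all (fun lam : {ffun V -> A} => word_val lam w != 0%R) (forms t).

Fixpoint generic (t : seq (seq (letter V))) : bool :=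
  if t is w :: t' then avoids t' w && generic t' else true.

Lemma hyperplanes_rare (K m : nat) :
  exists L0, forall L, L0 <= L -> forall s : seq {ffun V -> A}, size s <= m ->
    (forall lam, lam \in s -> exists v, lam v != 0%R) ->
    K * #|[set w in bounded_reduced V L |
             ~~ all (fun lam : {ffun V -> A} => word_val lam w != 0%R) s]|
      <= #|bounded_reduced V L|.
Proof.
have [m0 | m_gt0] := posnP m.
  exists 0 => L _ s; rewrite m0 leqn0 size_eq0 => /eqP -> _ /=.
  rewrite (_ : [set w in _ | _] = finset.set0) ?cards0 ?muln0 //.
  by apply/setP => w; rewrite !inE andbF.
have [L0 L0P] := hyperplane_rare V (m * K); exists L0 => L LL0 s sm s_neq0.
rewrite -(leq_pmul2l m_gt0) mulnA.
apply: (@leq_trans (size s * #|bounded_reduced V L|)); last by rewrite leq_mul.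
elim: s {sm} s_neq0 => [|lam s IHs] s_neq0.
  rewrite (_ : [set w in _ | _] = finset.set0) ?cards0 ?muln0 //.
  by apply/setP => w; rewrite !inE andbF.
have [v lamv] := s_neq0 lam (mem_head _ _).
rewrite /= mulSn.
apply: leq_trans (leq_add (L0P L LL0 A lam v lamv) (IHs _)); last first.
  by move=> mu mus; apply: s_neq0; rewrite inE mus orbT.
rewrite -mulnDr leq_mul //; apply: leq_trans (leq_card_setU _ _).
apply/subset_leq_card/fintype.subsetP => w; rewrite !inE negb_and negbK.
by move=> /andP[-> /orP[] ->]; rewrite ?orbT.
Qed.

Lemma generic_commands_cvg1 (R : realType) (n m : nat) :
  (forall t, size t < n -> generic t -> size (forms t) <= m /\
     forall lam, lam \in forms t -> exists v, lam v != 0%R) ->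
  (forall t, size t = n -> generic t ->
     commands (fun i : 'I_n => raag_elt e (nth [::] t i))) ->
  (command_prob R e n L @[L --> \oo] --> (1 : R)%R)%classic.
Proof.
move=> formsP genC; apply: command_prob_cvg1 => K.
have [L0 L0P] := hyperplanes_rare K m; exists L0 => L LL0.
pose vals (t : seq (L.-bseq (letter V))) := [seq val w | w <- t].
pose bad t : pred (L.-bseq (letter V)) := fun w => ~~ avoids (vals t) w.
have good_generic t : good (bounded_reduced V L) bad t ->
    generic (vals t) /\ all (mem (bounded_reduced V L)) t.
  elim: t => //= w t IHt /and3P[wS]; rewrite /bad negbK => -> /IHt[-> ->].
  by rewrite wS.
have bad_rare t : size t < n -> good (bounded_reduced V L) bad t ->
    K * #|[set w in bounded_reduced V L | bad t w]| <= #|bounded_reduced V L|.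
  move=> tn /good_generic[tG _]; have [|sm s0] := formsP (vals t) _ tG.
    by rewrite size_map.
  exact: L0P.
apply: leq_trans (card_good bad_rare) _; rewrite leq_add2l leq_mul //.
apply/subset_leq_card/fintype.subsetP => t.
rewrite !inE => /good_generic[tG tS].
apply/andP; split.
  by apply/forallP => i; have /all_tnthP/(_ i) := tS; rewrite /= inE.
apply/asboolP; have := genC (vals t); rewrite size_map size_tuple.
move=> /(_ erefl tG); congr commands; apply/funext => i.
by rewrite (nth_map (tnth t i)) ?size_tuple // -tnth_nth.
Qed.

End SequentialChoice.

(** * The two kinds of generic families *)

Section NonComplete.
Variables (V : finType) (e : rel V) (a b : V).
Hypotheses (ab : a != b) (eab : ~~ e a b) (eba : ~~ e b a).
Local Open Scope ring_scope.

(** The determinant against the exponent vector of w. *)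
Definition parallel_form (w : seq (letter V)) : {ffun V -> int} :=
  [ffun v => expo a w * (v == b)%:Z - expo b w * (v == a)%:Z].

(** The first form makes the exponent sum of a nonzero, which both conditions of
[commands_of_nonparallel] and the non-vanishing of [parallel_form] need. *)
Definition plane_forms (t : seq (seq (letter V))) : seq {ffun V -> int} :=
  [ffun v => (v == a)%:Z] :: map parallel_form t.

Lemma word_val_ffun (A : zmodType) (F : V -> A) w :
  word_val [ffun v => F v] w = word_val F w.
Proof. by apply: eq_bigr => c _; rewrite /letter_val ffunE. Qed.

Lemma generic_expo_neq0 t w :
  generic plane_forms t -> w \in t -> expo a w != 0.
Proof.
elim: t => //= w' t IHt /andP[/andP[w'0 _] /IHt tw].
by rewrite inE => /predU1P[-> | //]; rewrite word_val_ffun in w'0.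
Qed.

Lemma generic_pairwise t :
  generic plane_forms t ->
  pairwise (fun w w' => expo a w' * expo b w != expo b w' * expo a w) t.
Proof.
elim: t => //= w t IHt /andP[wt /IHt ->]; rewrite andbT.
move: wt; rewrite /avoids /plane_forms /= all_map => /andP[_].
by apply: sub_all => w' /=; rewrite word_val_ffun word_val_expo subr_eq0.
Qed.

Lemma nonadjacent_cvg1 (R : realType) n :
  (command_prob R e n L @[L --> \oo] --> (1 : R)%R)%classic.
Proof.
apply: (@generic_commands_cvg1 _ e int plane_forms R n n) => t tn tG.
  split=> [|lam]; first by rewrite /= size_map.
  rewrite inE => /predU1P[-> | /mapP[w wt ->]].
    by exists a; rewrite ffunE eqxx.
  exists b; rewrite ffunE eqxx [b == a]eq_sym (negbTE ab) mulr0 subr0 mulr1.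
  exact: generic_expo_neq0 tG wt.
have tE (i j : 'I_n) : i != j ->
    expo a (nth [::] t i) * expo b (nth [::] t j) !=
    expo a (nth [::] t j) * expo b (nth [::] t i).
  have /(pairwiseP [::]) tP := generic_pairwise tG.
  rewrite -val_eqE neq_ltn => /orP[] ij; have := tP _ _ _ _ ij.
    rewrite !inE tn !ltn_ord => /(_ isT isT).
    by rewrite eq_sym [expo b _ * _]mulrC.
  rewrite !inE tn !ltn_ord => /(_ isT isT).
  by rewrite [expo b _ * _]mulrC.
apply: commands_of_nonparallel ab eab eba _ tE => i.
by apply: generic_expo_neq0 tG _; rewrite mem_nth ?tn.
Qed.

End NonComplete.

Section Independent.
Variables (V : finType) (e : rel V).
Local Open Scope ring_scope.
Local Notation vT := {ffun V -> rat^o}.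

Definition unit_vec (v : V) : vT := [ffun x => (x == v)%:R].

Definition expo_vec (w : seq (letter V)) : vT := word_val unit_vec w.

Lemma word_val_lfun (g : 'End(vT)) (x : V) w :
  word_val (fun v => g (unit_vec v) x) w = g (expo_vec w) x.
Proof.
rewrite /expo_vec; elim: w => [|[v c] w IHw].
  by rewrite /word_val !big_nil linear0 ffunE.
rewrite !word_val_cons linearD ffunE IHw /letter_val /=.
by case: c; rewrite // linearN ffunE.
Qed.

(** Project onto a complement of the span of the exponent vectors of t, which is
not the whole space, and take a coordinate of this projection. *)
Lemma killing_form (t : seq (seq (letter V))) : (size t < #|V|)%N ->
  exists lam : {ffun V -> rat},
    (exists v, lam v != 0) /\ {in t, forall w, word_val lam w = 0}.
Proof.
move=> tV; pose U := <<map expo_vec t>>%VS.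
have [v vU] : exists v, unit_vec v \notin U.
  apply/existsP; apply: contraLR tV => /existsPn unitU.
  rewrite -leqNgt; have : (fullv <= U)%VS.
    apply/subvP => f _.
    have -> : f = \sum_v f v *: unit_vec v.
      apply/ffunP=> x; rewrite sum_ffunE (bigD1 x) //= big1 => [|y yx].
        by rewrite !ffunE eqxx addr0 /GRing.scale /= mulr1.
      by rewrite !ffunE eq_sym (negbTE yx) scaler0.
    apply: memv_suml => v _; rewrite memvZ //.
    by have := unitU v; rewrite negbK.
  move/dimvS; rewrite dimvf /dim /= muln1 => /leq_trans; apply.
  by rewrite (leq_trans (dim_span _)) ?size_map.
pose g : 'End(vT) := (\1 - projv U)%VF.
have [x gx] : exists x, g (unit_vec v) x != 0.
  apply/existsP; apply: contraR vU => /existsPn g0.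
  have /eqP : g (unit_vec v) = 0.
    by apply/ffunP => x; rewrite ffunE; apply/eqP; have := g0 x; rewrite negbK.
  by rewrite lfunE /= lfunE /= opp_lfunE subr_eq0 => /eqP ->; apply: memv_proj.
exists [ffun v => g (unit_vec v) x]; split; first by exists v; rewrite ffunE.
move=> w wt; rewrite word_val_ffun word_val_lfun.
have -> : g (expo_vec w) = 0; last by rewrite ffunE.
have wU : expo_vec w \in U by apply/memv_span/map_f.
by rewrite lfunE /= lfunE /= opp_lfunE projv_id // subrr.
Qed.

Lemma word_val_pairing (lam : V -> rat) w :
  word_val lam w = \sum_v expo_vec w v * lam v.
Proof.
rewrite /expo_vec; elim: w => [|[v c] w IHw].
  by rewrite /word_val !big_nil big1 // => v _; rewrite ffunE mul0r.
rewrite !word_val_cons IHw; under [RHS]eq_bigr => x _ do rewrite ffunE mulrDl.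
rewrite big_split /=; congr (_ + _); rewrite (bigD1 v) //= big1 => [|x xv].
  rewrite /letter_val /= addr0.
  by case: c; rewrite !ffunE eqxx ?mulN1r ?mul1r.
rewrite /letter_val /=; case: c; rewrite !ffunE (negbTE xv) ?oppr0 mul0r //.
Qed.

(** A word on which such a form does not vanish has an exponent vector outside
the span of those of t. *)
Definition span_forms (t : seq (seq (letter V))) : seq {ffun V -> rat} :=
  if pselect (exists lam : {ffun V -> rat},
    (exists v, lam v != 0) /\ {in t, forall w, word_val lam w = 0}) is left h
  then [:: sval (cid h)] else [::].

Lemma generic_free t :
  (size t <= #|V|)%N -> generic span_forms t -> free (map expo_vec t).
Proof.
elim: t => [|w t IHt] tV; first by rewrite nil_free.
rewrite /= => /andP[wt tG]; rewrite free_cons IHt // 1?ltnW // andbT.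
move: wt; rewrite /avoids /span_forms.
case: pselect => [h | []]; last exact: killing_form.
case: (cid h) => lam [_ lam0] /=; rewrite andbT; apply: contra => wU.
have {}wU : expo_vec w \in <<in_tuple (map expo_vec t)>>%VS by [].
rewrite word_val_pairing (coord_span wU).
under eq_bigr => v _ do rewrite sum_ffunE big_distrl.
rewrite exchange_big big1 // => i _ /=.
under eq_bigr => v _ do rewrite ffunE -mulrA.
rewrite -mulr_sumr -[nth _ _ _]/((map expo_vec t)`_i).
have it : (i < size t)%N by rewrite -(size_map expo_vec) ltn_ord.
by rewrite (nth_map [::]) // -word_val_pairing lam0 ?mulr0 ?mem_nth.
Qed.

Lemma clear_denominators (phi : V -> rat) :
  exists (d : int) (psi : V -> int),
    d != 0 /\ forall v, (psi v)%:~R = d%:~R * phi v.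
Proof.
exists (\prod_v denq (phi v)).
exists (fun v => numq (phi v) * \prod_(u | u != v) denq (phi u)); split.
  by apply/prodf_neq0 => v _; rewrite denq_neq0.
move=> v; rewrite [in RHS](bigD1 v) //= !intrM mulrAC; congr (_ * _).
by rewrite numqE mulrC.
Qed.

(** The coordinate forms of a free family are dual to it; after clearing
denominators they have integer values. *)
Lemma commands_of_free n (u : 'I_n -> seq (letter V)) :
  free [tuple expo_vec (u i) | i < n] -> commands (fun i => raag_elt e (u i)).
Proof.
set X := [tuple _ | _ < _] => X_free.
have XE (i : 'I_n) : X`_i = expo_vec (u i) by rewrite -tnth_nth tnth_mktuple.
pose phi i v := coord X i (unit_vec v).
have phiE i j : word_val (phi i) (u j) = (i == j)%:R.
  have := coord_free j i X_free; rewrite XE eq_sym => <-.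
  exact: (word_val_raddf (coord X i)).
have /choice[d dP] i := clear_denominators (phi i).
have /choice[psi psiP] := dP.
have psiE i j : (word_val (psi i) (u j))%:~R = (d i)%:~R * (i == j)%:R :> rat.
  rewrite -phiE mulr_sumr /word_val rmorph_sum /=; apply: eq_bigr => c _.
  rewrite /letter_val; case: (psiP i) => _ psi_i.
  by case: c.2; rewrite ?rmorphN /= psi_i ?mulrN.
apply: (@commands_of_dual_forms _ _ _ _ psi) => [i | i j ij].
  by rewrite -(intr_eq0 rat) psiE eqxx mulr1 intr_eq0; case: (psiP i).
by apply/eqP; rewrite -(intr_eq0 rat) psiE (negbTE ij) mulr0.
Qed.

Lemma large_rank_cvg1 (R : realType) n : (n <= #|V|)%N ->
  (command_prob R e n L @[L --> \oo] --> (1 : R)%R)%classic.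
Proof.
move=> nV; apply: (@generic_commands_cvg1 _ e rat span_forms R n 1) => t tn tG.
  rewrite /span_forms; case: pselect => [h | //]; split=> // lam.
  by rewrite inE => /eqP ->; case: (cid h) => mu [].
apply: commands_of_free.
rewrite (_ : tval _ = map expo_vec t).
  by apply: generic_free; rewrite ?tn.
apply: (@eq_from_nth _ 0) => [|i]; rewrite size_tuple ?size_map // => i_n.
rewrite (nth_map [::]) ?tn // -[i]/(val (Ordinal i_n)) -tnth_nth.
by rewrite tnth_mktuple.
Qed.

End Independent.

Theorem theorem7p8 (R : realType) (V : finType) (e : rel V)
    (esym : symmetric e) (eirr : irreflexive e) (n : nat) (n_ge1 : 1 <= n)
    (not_small_complete : ~ (complete_graph e /\ #|V| < n)) :
  (command_prob R e n L @[L --> \oo] --> (1 : R)%R)%classic.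
Proof.
have [nV | Vn] := leqP n #|V|; first exact: large_rank_cvg1.
have [a [b [ab eab]]] : exists a b, a != b /\ ~~ e a b.
  apply: contrapT => e_complete; apply: not_small_complete; split=> // a b ab.
  by apply: contrapT => /negP eab; apply: e_complete; exists a, b.
have eba : ~~ e b a by rewrite esym.
exact: nonadjacent_cvg1 ab eab eba R n.
Qed.
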